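(* Every LCM subsemigroup $\mathcal{N}$ of $\mathbb{N}^\times$ is freely generated (as an abelian monoid) by its irreducible elements $\mathrm{Irr}\,\mathcal{N}$. In particular, if $S$ is a right LCM monoid and $N\colon S\to\mathbb{N}^\times$ is a generalized scale, then $N(S)$ is freely generated by $\mathrm{Irr}\,N(S)$.
   Context: $\mathbb{N}^\times$ denotes the multiplicative monoid of positive integers. An LCM subsemigroup of $\mathbb{N}^\times$ is a submonoid $\mathcal{N}$ (containing $1$) that is itself a right LCM monoid, i.e. for all $m,n\in\mathcal{N}$ there is $r\in\mathcal{N}$ with $m\mathcal{N}\cap n\mathcal{N}=r\mathcal{N}$. Its irreducible elements are $\mathrm{Irr}\,\mathcal{N}:=\{n\in\mathcal{N}\setminus\{1\}\mid n=k\ell\text{ for }k,\ell\in\mathcal{N}\Rightarrow k=1\text{ or }\ell=1\}$. A right LCM monoid is a left cancellative monoid $S$ (with unit) in which the intersection $sS\cap tS$ of any two principal right ideals is either empty or again a principal right ideal. For $s,t\in S$ write $s\Cap t$ if $sS\cap tS\neq\emptyset$, and $s\perp t$ otherwise. The core of $S$ is $S_c:=\{a\in S\mid a\Cap s\text{ for all }s\in S\}$. Elements $s,t\in S$ are core equivalent, $s\sim t$, if there are $a,b\in S_c$ with $sa=tb$; this is an equivalence relation. A generalized scale on $S$ is a nontrivial homomorphism (not identically $1$) $N\colon S\to\mathbb{N}^\times$, $s\mapsto N_s$, such that: (1) $|N^{-1}(n)/_\sim|=n$ for all $n\in N(S)$; (2) $N_s=N_t$ implies $s\sim t$ or $s\perp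 t$; (3) for all $s\in S$ and $n\in N(S)$ there exists $t\in N^{-1}(n)$ with $s\Cap t$. *)

(* Defs.v *)
From HB Require Import structures.
From mathcomp Require Import all_boot finmap multiset.
From mathcomp Require Import boolp classical_sets functions cardinality.

Set Implicit Arguments.
Unset Strict Implicit.
Unset Printing Implicit Defensive.

Local Open Scope classical_set_scope.
Local Open Scope card_scope.

(* The multiplicative monoid of positive integers is represented by the
   positive elements of [nat] with [muln]; its submonoids are sets of [nat]. *)

Record lcm_subsemigroup (M : set nat) : Prop := LcmSubsemigroup {
  lcm_sub_pos : forall n : nat, M n -> 0 < n;
  lcm_sub1 : M 1;
  lcm_subM : forall m n : nat, M m -> M n -> M (m * n);
  lcm_subI : forall m n : nat, M m -> M n ->
    exists2 r : nat, M r & (muln m @` M) `&` (muln n @` M) = muln r @` M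
}.

Definition irreducibles (M : set nat) : set nat :=
  [set n | [/\ M n, n <> 1 &
    forall k l : nat, M k -> M l -> n = k * l -> k = 1 \/ l = 1]].

(* The free abelian monoid on a set [X] consists of the finite multisets of
   elements of [X]; [mset_prod] is the canonical homomorphism from it to the
   multiplicative monoid of integers which extends the inclusion of [X]. *)
Definition mset_prod (A : {mset nat}%mset) : nat :=
  \prod_(x <- finsupp A) x ^ A x.

Definition msets_on (X : set nat) : set {mset nat}%mset :=
  [set A | forall x : nat, x \in A -> X x].

Definition freely_generated (M X : set nat) : Prop :=
  set_bij (msets_on X) M mset_prod.

Section RightLCM.
Variable S : monoidType.
Implicit Types (s t a b : S).

Definition principal_right_ideal s : set S := range (fun x : S => (s * x)%g).

Definition right_lcm_monoid : Prop :=
  (forall s t t' : S, (s * t = s * t')%g -> t = t') /\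
  (forall s t : S,
     principal_right_ideal s `&` principal_right_ideal t = set0 \/
     exists r : S, principal_right_ideal s `&` principal_right_ideal t =
                   principal_right_ideal r).

Definition meets s t : Prop :=
  principal_right_ideal s `&` principal_right_ideal t !=set0.

Definition core : set S := [set a | forall s, meets a s].

Definition core_equiv s t : Prop :=
  exists a b, [/\ core a, core b & (s * a = t * b)%g].

Definition fiber (N : S -> nat) (n : nat) : set S := [set s | N s = n].

Definition fiber_classes (N : S -> nat) (n : nat) : set (set S) :=
  [set fiber N n `&` [set t | core_equiv s t] | s in fiber N n].

Record generalized_scale (N : S -> nat) : Prop := GeneralizedScale {
  scale_pos : forall s, 0 < N s;
  scale1 : N 1%g = 1;
  scaleM : forall s t, N (s * t)%g = N s * N t;
  scale_nontrivial : exists s, N s <> 1;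
  scale_card : forall n : nat, range N n -> fiber_classes N n #= `I_n;
  scale_fiber : forall s t, N s = N t -> core_equiv s t \/ ~ meets s t;
  scale_meets : forall s (n : nat), range N n ->
    exists2 t, fiber N n t & meets s t
}.

End RightLCM.

(* Main.v *)
Require Import Defs.
From mathcomp Require Import all_boot classical_sets.
From mathcomp Require Import finmap multiset boolp functions cardinality.

(** Let [M] be an LCM subsemigroup. If an irreducible [p] divides [a * b] in [M]
    and [r] generates [pM `&` aM], say [r = p * x = a * y], then [r] divides
    [p * a] in [M], so [y] divides [p] in [M]. Either [y = 1] and [p] divides [a],
    or [y = p] and [p] divides [b]. Hence irreducibles are prime in [M], and
    factorizations into irreducibles are unique.

    For a generalized scale [N] and [s] with [N s = m], take [m] pairwise
    orthogonal elements of scale [m] and [a] of scale [a]: their products are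
    [m * a] pairwise orthogonal elements of scale [m * a], hence represent all
    the classes in this fiber. So every [u] with [N u = m * a] which meets [s]
    can be moved into [sS] by a core element, and core elements have scale 1.
    Applying this to [s] and [t] with [sS `&` tS = rS] and to a [u] which meets
    [r] shows that [N r] generates the intersection of the ideals of [N s] and
    [N t] in the range of [N]. *)

Set Implicit Arguments.
Unset Strict Implicit.
Unset Printing Implicit Defensive.

(* [classical_sets] exports another [meets]. *)
Local Notation meets := Defs.meets.

Lemma mset_prodE (A : {mset nat}%mset) : mset_prod A = \prod_(x <- A) x.
Proof. by rewrite prod_mset. Qed.

Lemma mset_prod_seq_mset (s : seq nat) :
  mset_prod (seq_mset s) = \prod_(x <- s) x.
Proof. by rewrite mset_prodE; apply: perm_big; apply: perm_eq_seq_mset. Qed.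

(** * Unique factorization in an LCM subsemigroup *)

Section UniqueFactorization.
Variable M : set nat.
Hypothesis lcmM : lcm_subsemigroup M.
Local Notation irr := (irreducibles M).

Lemma irr_prime p a b c :
  irr p -> M a -> M b -> M c -> a * b = p * c ->
  (exists2 z, M z & a = p * z) \/ (exists2 z, M z & b = p * z).
Proof.
case=> Mp _ p_irr Ma Mb Mc abpc.
have a0 := lcm_sub_pos lcmM Ma.
have [r Mr Er] := lcm_subI lcmM Mp Ma.
have [[x Mx rpx] [y My ray]] : ((muln p @` M) `&` (muln a @` M))%classic r.
  by rewrite Er; exists 1; [exact: lcm_sub1 | exact: muln1].
have [z Mz abrz] : (muln r @` M)%classic (a * b).
  by rewrite -Er; split; [exists c | exists b].
have [w Mw parw] : (muln r @` M)%classic (p * a).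
  by rewrite -Er; split; [exists a | exists p; rewrite // mulnC].
have pyw : p = y * w.
  by apply/eqP; rewrite -(eqn_pmul2l a0) mulnA ray parw mulnC.
have [y1|w1] := p_irr _ _ My Mw pyw; [left; exists x|right; exists z] => //.
  by rewrite rpx -ray y1 muln1.
by apply/eqP; rewrite -(eqn_pmul2l a0) -abrz -ray pyw w1 muln1 mulnA.
Qed.

Lemma irr_gt1 p : irr p -> 1 < p.
Proof.
case=> /(lcm_sub_pos lcmM) + /eqP.
by case: p => [|[]].
Qed.

Lemma prod_irr_mem (s : seq nat) :
  {in s, forall x, irr x} -> M (\prod_(x <- s) x).
Proof.
elim: s => [_|x s IH irr_s]; first by rewrite big_nil; apply: lcm_sub1.
rewrite big_cons; apply: lcm_subM => //.
  by have [] := irr_s x (mem_head _ _).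
by apply: IH => y ys; apply: irr_s; rewrite inE ys orbT.
Qed.

(** Divisibility is meant inside [M], so the cofactor [c] must lie in [M]. Primality of [p] peels
    off one factor at a time, and an irreducible factor divisible by [p] equals [p]. *)
Lemma irr_dvd_prod p c (s : seq nat) :
  irr p -> {in s, forall x, irr x} -> M c ->
  \prod_(x <- s) x = p * c -> p \in s.
Proof.
move=> irr_p + Mc; elim: s c Mc => [|x s IH] c Mc irr_s.
  rewrite big_nil => /esym/eqP; rewrite muln_eq1 => /andP[/eqP p1 _].
  by have := irr_gt1 irr_p; rewrite p1.
have irr_s' : {in s, forall x, irr x}.
  by move=> y ys; apply: irr_s; rewrite inE ys orbT.
have irr_x := irr_s x (mem_head _ _).
have [Mx _ x_irr] := irr_x.
rewrite big_cons => E.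
have [[z Mz xpz]|[z Mz spz]] := irr_prime irr_p Mx (prod_irr_mem irr_s') Mc E.
  have [Mp _ _] := irr_p.
  have [p1|z1] := x_irr _ _ Mp Mz xpz.
    by have := irr_gt1 irr_p; rewrite p1.
  by rewrite xpz z1 muln1 mem_head.
by rewrite inE (IH z) ?orbT.
Qed.

Lemma prod_irr_inj (s t : seq nat) :
  {in s, forall x, irr x} -> {in t, forall x, irr x} ->
  \prod_(x <- s) x = \prod_(x <- t) x -> perm_eq s t.
Proof.
elim: s t => [|x s IH] t irr_s irr_t.
  case: t irr_t => // y t irr_t; rewrite big_nil big_cons => /esym/eqP.
  rewrite muln_eq1 => /andP[/eqP y1 _].
  by have := irr_gt1 (irr_t y (mem_head _ _)); rewrite y1.
have irr_s' : {in s, forall x, irr x}.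
  by move=> y ys; apply: irr_s; rewrite inE ys orbT.
have irr_x := irr_s x (mem_head _ _).
rewrite big_cons => E.
have xt : x \in t by apply: irr_dvd_prod (prod_irr_mem irr_s') (esym E).
rewrite perm_sym (permPl (perm_to_rem xt)) perm_cons perm_sym.
apply: IH => //; first by move=> y /mem_rem; apply: irr_t.
have := E; rewrite (perm_big _ (perm_to_rem xt)) big_cons => /eqP.
by rewrite eqn_pmul2l => [/eqP//|]; apply: ltnW (irr_gt1 irr_x).
Qed.

Lemma irr_factorization n :
  M n -> exists2 s : seq nat, {in s, forall x, irr x} & n = \prod_(x <- s) x.
Proof.
elim/ltn_ind: n => n IH Mn.
have [->|/eqP n1] := EM (n = 1); first by exists [::]; rewrite ?big_nil.
have [irr_n|] := EM (irr n).
  exists [:: n]; last by rewrite big_seq1.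
  by move=> x; rewrite inE => /eqP->.
move=> /not_and3P; case=> [//|/contrapT n1'|]; first by rewrite n1' in n1.
move=> /existsNP[k] /existsNP[l] /not_implyP[Mk] /not_implyP[Ml].
move=> /not_implyP[nkl] /not_orP[/eqP k1 /eqP l1].
have k0 := lcm_sub_pos lcmM Mk; have l0 := lcm_sub_pos lcmM Ml.
have k_gt1 : 1 < k by rewrite ltn_neqAle eq_sym k1.
have l_gt1 : 1 < l by rewrite ltn_neqAle eq_sym l1.
have [||s irr_s Es] := IH k => //; first by rewrite nkl ltn_Pmulr.
have [||t irr_t Et] := IH l => //; first by rewrite nkl ltn_Pmull.
exists (s ++ t); last by rewrite big_cat -Es -Et.
by move=> x; rewrite mem_cat => /orP[/irr_s|/irr_t].
Qed.

Lemma lcm_subsemigroup_freely_generated : freely_generated M irr.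
Proof.
split.
- by move=> A irr_A; rewrite mset_prodE; apply: prod_irr_mem.
- move=> A B /set_mem irr_A /set_mem irr_B; rewrite !mset_prodE => E.
  rewrite -(seq_mset_id A) -(seq_mset_id B).
  by apply/eq_seq_msetP; apply: prod_irr_inj.
- move=> n /irr_factorization[s irr_s ->]; exists (seq_mset s).
    by move=> x; rewrite (perm_mem (perm_eq_seq_mset s)); apply: irr_s.
  exact: mset_prod_seq_mset.
Qed.

End UniqueFactorization.

(** * Core equivalence and intersecting principal right ideals *)

Section CoreEquivalence.
Variable S : monoidType.
Implicit Types s t u : S.
Local Open Scope group_scope.

Lemma meetsP s t : meets s t <-> exists x y, s * x = t * y.
Proof.
split=> [[_ [[x _ <-] [y _ E]]]|[x [y E]]]; first by exists x, y.
by exists (s * x); split; [exists x | exists y].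
Qed.

Lemma meets_sym s t : meets s t -> meets t s.
Proof. by move=> /meetsP[x [y E]]; apply/meetsP; exists y, x. Qed.

Lemma meets_mul s t x y : meets (s * x) (t * y) -> meets s t.
Proof.
move=> /meetsP[a [b E]]; apply/meetsP.
by exists (x * a), (y * b); rewrite !mulgA.
Qed.

Lemma core1 : core (1 : S).
Proof. by move=> s; apply/meetsP; exists s, 1; rewrite mul1g mulg1. Qed.

Lemma core_equiv_refl s : core_equiv s s.
Proof. by exists 1, 1; split=> //; apply: core1. Qed.

Lemma core_equiv_sym s t : core_equiv s t -> core_equiv t s.
Proof. by case=> a [b [ca cb E]]; exists b, a. Qed.

(** If [u * x = s * y] and [s * a = t * b], the core element [a] meets [y], say [a * p = y * q];
    then [u * x * q = s * a * p = t * b * p]. *)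
Lemma meets_core_equiv u s t : meets u s -> core_equiv s t -> meets u t.
Proof.
move=> /meetsP[x [y E]] [a [b [ca _ F]]].
have /meetsP[p [q G]] := ca y.
apply/meetsP; exists (x * q), (b * p).
by rewrite mulgA E -mulgA -G mulgA F -mulgA.
Qed.

Lemma core_equiv_meets s t : core_equiv s t -> meets s t.
Proof.
apply: meets_core_equiv; apply: (@meets_mul s s 1 1).
by apply/meetsP; exists 1, 1.
Qed.

End CoreEquivalence.

(** * Fibers of a generalized scale *)

Section GeneralizedScale.
Variables (S : monoidType) (N : S -> nat).
Hypotheses (lcmS : right_lcm_monoid S) (scaleN : generalized_scale N).
Implicit Types s t u : S.
Local Open Scope group_scope.

Lemma scale_meets_core_equiv s t : N s = N t -> meets s t -> core_equiv s t.
Proof. by move=> /(scale_fiber scaleN)[]. Qed.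

Lemma scale_class_eqP s t : N s = N t ->
  (fiber N (N s) `&` [set x | core_equiv s x] =
   fiber N (N t) `&` [set x | core_equiv t x])%classic <-> core_equiv s t.
Proof.
move=> Nst; split.
  move=> E; have : (fiber N (N t) `&` [set x | core_equiv t x])%classic t.
    by split=> //; apply: core_equiv_refl.
  by rewrite -E => -[].
have sub x y : N x = N y -> core_equiv x y ->
    (fiber N (N x) `&` [set z | core_equiv x z] `<=`
     fiber N (N y) `&` [set z | core_equiv y z])%classic.
  move=> Nxy xy z [Nz xz]; split; first by rewrite /fiber /= -Nxy.
  (* Inside a fiber, transitivity follows from the fact that meeting and core equivalence coincide
     there. *)
  apply: scale_meets_core_equiv; first by rewrite -Nxy.
  by apply: meets_core_equiv xz; apply/meets_sym/core_equiv_meets.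
move=> st; apply/seteqP; split; apply: sub => //.
exact: core_equiv_sym.
Qed.

(** One representative is chosen in each of the [n] classes; two that meet are core equivalent, so
    they represent the same class. *)
Lemma fiber_transversal n : range N n ->
  exists g : 'I_n -> S, [/\ forall i, N (g i) = n,
    forall i j, meets (g i) (g j) -> i = j &
    forall s, N s = n -> exists i, meets s (g i)].
Proof.
move=> /(scale_card scaleN)/card_set_bijP[f [f_fun f_inj f_surj]].
pose cl s := (fiber N n `&` [set x | core_equiv s x])%classic.
have /choice[g gP] : forall i : 'I_n, exists s, N s = n /\ f (cl s) = i.
  move=> i; have [_ [s Ns <-] fs] := f_surj i (ltn_ord i).
  by exists s.
exists g; split=> [i|i j gij|s Ns]; first by have [] := gP i.
  have [Ni fi] := gP i; have [Nj fj] := gP j.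
  apply: val_inj; rewrite /= -fi -fj; congr f.
  have := scale_meets_core_equiv (etrans Ni (esym Nj)) gij.
  by move/scale_class_eqP; rewrite Ni Nj; apply.
have fsn : f (cl s) < n by apply: f_fun; exists s.
pose i := Ordinal fsn; exists i.
have [Ni fi] := gP i.
have E : cl s = cl (g i).
  by apply: f_inj; rewrite ?fi //; apply/mem_set; [exists s | exists (g i)].
apply: core_equiv_meets; apply/scale_class_eqP; first by rewrite Ns Ni.
by rewrite Ns Ni.
Qed.

(** A core element meets the whole transversal of its own fiber, which therefore consists of a
    single class. *)
Lemma scale_core c : core c -> N c = 1%N.
Proof.
move=> core_c.
have [|g [gN g_inj _]] := @fiber_transversal (N c); first by exists c.
have gc i : core_equiv c (g i).
  by apply: scale_meets_core_equiv; [rewrite gN | apply: core_c].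
apply/eqP; rewrite eqn_leq (scale_pos scaleN) andbT leqNgt.
apply/negP => c_gt1.
have c_gt0 := ltnW c_gt1.
have : Ordinal c_gt0 = Ordinal c_gt1.
  apply: g_inj; apply: (meets_core_equiv _ (gc _)).
  by apply: meets_sym; apply: core_c.
by case.
Qed.

(* The products of two transversals form a transversal of the larger fiber,
   which pins down the class of [u] as that of a multiple of [s]. *)
Lemma scale_meets_absorb s u a : range N a -> N u = (N s * a)%N ->
  meets u s -> exists c y, core c /\ u * c = s * y.
Proof.
move=> rangea Nu us.
have [|g [gN g_inj g_all]] := @fiber_transversal (N s); first by exists s.
have [h [hN h_inj _]] := fiber_transversal rangea.
have [|G [GN G_inj G_all]] := @fiber_transversal (N u); first by exists u.
have [i0 si0] := g_all s erefl.
(* The representative of the class of [s] is replaced by [s] itself. *)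
pose g' i := if i == i0 then s else g i.
have g'N i : N (g' i) = N s by rewrite /g'; case: eqP.
have g'_inj i j : meets (g' i) (g' j) -> i = j.
  have sg k : meets (g k) s -> k = i0.
    move=> gs; apply: g_inj; apply: meets_core_equiv gs _.
    by apply: scale_meets_core_equiv; rewrite ?gN.
  rewrite /g'; have [->|_] := eqVneq i i0; have [->|_] := eqVneq j i0 => //.
  - by move=> /meets_sym /sg.
  - by move=> /sg.
  - exact: g_inj.
pose w (ij : 'I_(N s) * 'I_a) := g' ij.1 * h ij.2.
have wN ij : N (w ij) = N u by rewrite (scaleM scaleN) g'N hN Nu.
have w_inj p q : meets (w p) (w q) -> p = q.
  case: p q => [i j] [i' j'] m.
  have ii' : i = i' by apply: g'_inj; apply: meets_mul m.
  subst i'; congr (_, _); apply: h_inj.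
  (* Left cancellation of the common factor reduces to [h]. *)
  case/meetsP: m => x [y]; rewrite /w /= -!mulgA => /(proj1 lcmS) E.
  by apply/meetsP; exists x, y.
have /choice[phi phiP] : forall p, exists l, meets (w p) (G l).
  by move=> p; apply: G_all.
have phi_equiv p : core_equiv (w p) (G (phi p)).
  by apply: scale_meets_core_equiv; rewrite ?wN ?GN.
have phi_inj : injective phi.
  move=> p q E; apply: w_inj; apply: meets_core_equiv (phiP p) _.
  by rewrite E; apply: core_equiv_sym.
have [l ul] := G_all u erefl.
(* Both index sets have [N s * a] elements, so the injection [phi] is onto. *)
have /codomP[[i j] E] : l \in codom phi.
  apply: inj_card_onto => //.
  by rewrite card_prod !card_ord Nu.
have uw : meets u (w (i, j)).
  by apply: meets_core_equiv ul _; rewrite E; apply: core_equiv_sym.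
have uw_equiv : core_equiv u (w (i, j)) by apply: scale_meets_core_equiv.
have ii0 : i = i0.
  apply: g'_inj; rewrite {2}/g' eqxx; apply: meets_sym.
  apply: (@meets_mul _ s (g' i) 1 (h j)); rewrite mulg1.
  by apply: meets_core_equiv uw_equiv; apply: meets_sym.
have [c [d [core_c _ F]]] := uw_equiv.
exists c, (h j * d); split=> //.
by rewrite F /w /= ii0 /g' eqxx mulgA.
Qed.

Lemma lcm_subsemigroup_range : lcm_subsemigroup (range N).
Proof.
split.
- by move=> _ [s _ <-]; apply: scale_pos.
- by exists 1 => //; apply: scale1.
- by move=> _ _ [s _ <-] [t _ <-]; exists (s * t) => //; apply: scaleM.
move=> _ _ [s _ <-] [t0 _ <-].
(* [t0] may be orthogonal to [s]; an element of the same scale that meets [s] takes its place. *)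
have [|t Nt st] := scale_meets scaleN s (n := N t0); first by exists t0.
rewrite -Nt.
have [st0|[r Er]] := proj2 lcmS s t.
  by move: st; rewrite /meets st0 => -[].
have [[x _ rx] [y _ ry]] :
    (principal_right_ideal s `&` principal_right_ideal t)%classic r.
  by rewrite Er; exists 1; rewrite ?mulg1.
exists (N r); first by exists r.
apply/seteqP; split=> [k|_ [_ [z _ <-] <-]]; last first.
  split; [exists (N (x * z)) | exists (N (y * z))]; try by eexists.
    by rewrite -!(scaleM scaleN) mulgA rx.
  by rewrite -!(scaleM scaleN) mulgA ry.
move=> [[a rangea ka] [b rangeb kb]].
have rangek : range N k.
  by case: rangea ka => v _ <- <-; exists (s * v); rewrite ?(scaleM scaleN).
have [u Nu /meetsP[p [q E]]] := scale_meets scaleN r rangek.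
have us : meets u s.
  by apply/meetsP; exists q, (x * p); rewrite -E -rx mulgA.
have [|c [y1 [core_c uc]]] := scale_meets_absorb rangea _ us; first by rewrite ka.
(* Since [c] meets [q], the element [u * c] still has a right multiple in common with
   [u * q = r * p], which lies in the ideal of [t]. *)
have ut : meets (u * c) t.
  have /meetsP[c1 [x1 F]] := core_c q.
  by apply/meetsP; exists c1, (y * (p * x1)); rewrite -mulgA F !mulgA -E -ry.
have Nuc : N (u * c) = k by rewrite (scaleM scaleN) (scale_core core_c) muln1.
have [|d [y2 [core_d ucd]]] := scale_meets_absorb rangeb _ ut; first by rewrite Nuc kb.
have : principal_right_ideal r (u * c * d).
  by rewrite -Er; split; [exists (y1 * d); rewrite // uc mulgA | exists y2].
case=> z _ rz; exists (N z); first by exists z.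
by rewrite -(scaleM scaleN) rz (scaleM scaleN) (scale_core core_d) Nuc muln1.
Qed.

End GeneralizedScale.

Theorem proposition3p1 :
  (forall M : set nat, lcm_subsemigroup M ->
     freely_generated M (irreducibles M)) /\
  (forall (S : monoidType) (N : S -> nat),
     right_lcm_monoid S -> generalized_scale N ->
     freely_generated (range N) (irreducibles (range N))).
Proof.
split=> [M lcmM|S N lcmS scaleN]; apply: lcm_subsemigroup_freely_generated => //.
exact: lcm_subsemigroup_range.
Qed.
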